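(* Let $\mathcal{X} := (X, =_X, \neq_X, <_X)$ and $\mathcal{Y} := (Y, =_Y, \neq_Y, <_Y)$ be $\exists$-well-founded sets, and let $A \subseteq X$. Then, constructively: (i) If $\mathcal{Z} := (Z, =_Z, \neq_Z, <_Z)$ is a set with an extensional inequality and relation, and $f \colon Z \to X$ is a strongly extensional function that preserves the relations, then $\mathcal{Z}$ is an $\exists$-well-founded set. If $\mathcal{X}$ is strong, then $\mathcal{Z}$ is strong. (ii) If $=_A$, $\neq_A$ and $<_A$ are the restrictions to $A$ of $=_X$, $\neq_X$ and $<_X$, respectively, then $\mathcal{A} := (A, =_A, \neq_A, <_A)$ is an $\exists$-well-founded set. (iii) The product $\mathcal{X} \times \mathcal{Y} := (X \times Y, =_{X \times Y}, \neq_{X \times Y}, <_{X \times Y})$, where $=_{X\times Y}$ is componentwise equality, $$(x, y) \neq_{X \times Y} (x', y') :\Leftrightarrow x \neq_X x' \vee y \neq_Y y',$$ $$(x, y) <_{X \times Y} (x', y') :\Leftrightarrow x <_X x' \ \&\ y <_Y y',$$ is an $\exists$-well-founded set. If $\mathcal{X}$, or $\mathcal{Y}$, is strong, then $\mathcal{X} \times \mathcal{Y}$ is strong. (iv) The sum $\mathcal{X} + \mathcal{Y} := (X + Y, =_{X + Y}, \neq_{X + Y}, <_{X + Y})$, where the elements of $X+Y$ are the pairs $(0,x)$ with $x \in X$ and the pairs $(1,y)$ with $y \in Y$, and $$(i, z) =_{X + Y} (j, u) :\Leftrightarrow (i =_{\mathbf{2}} j =_{\mathbf{2}} 0 \ \&\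 z =_X u) \vee (i =_{\mathbf{2}} j =_{\mathbf{2}} 1 \ \&\ z =_Y u),$$ $$(i, z) \neq_{X + Y} (j, u) :\Leftrightarrow i \neq_{\mathbf{2}} j \vee (i =_{\mathbf{2}} j =_{\mathbf{2}} 0 \ \&\ z \neq_X u) \vee (i =_{\mathbf{2}} j =_{\mathbf{2}} 1 \ \&\ z \neq_Y u),$$ $$(i, z) <_{X + Y} (j, u) :\Leftrightarrow i <_{\mathbf{2}} j \vee (i =_{\mathbf{2}} j =_{\mathbf{2}} 0 \ \&\ z <_X u) \vee (i =_{\mathbf{2}} j =_{\mathbf{2}} 1 \ \&\ z <_Y u),$$ is an $\exists$-well-founded set. If $\mathcal{X}$ and $\mathcal{Y}$ are strong, then $\mathcal{X} + \mathcal{Y}$ is strong; if $\mathcal{X}$ and $\mathcal{Y}$ are dichotomous, then $\mathcal{X} + \mathcal{Y}$ is dichotomous.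
   Context: Setting: Bishop-style constructive mathematics (intuitionistic reasoning). $\bot_{\mathbb{N}} := (0 =_{\mathbb{N}} 1)$. A set with an extensional inequality and relation is a structure $\mathcal{X} = (X, =_X, \neq_X, <_X)$, where $=_X$ is an equivalence relation (the equality of $X$); $\neq_X$ is a binary relation on $X$ such that $x =_X y \ \&\ x \neq_X y \Rightarrow \bot_{\mathbb{N}}$, $x \neq_X y \Rightarrow y \neq_X x$, and $\neq_X$ is extensional ($x =_X x'$, $y =_X y'$ and $x \neq_X y$ imply $x' \neq_X y'$); and $<_X$ is an extensional binary relation on $X$ ($x =_X x'$, $y =_X y'$ and $x <_X y$ imply $x' <_X y'$). No further property of $<_X$ is assumed. $\mathcal{X}$ is strong if $x <_X x' \Rightarrow x \neq_X x'$ for all $x,x' \in X$, and dichotomous if $x \neq_X x' \Rightarrow (x <_X x' \vee x' <_X x)$ for all $x,x' \in X$. Functions respect equality. A function $f \colon X \to Y$ is strongly extensional if $f(x) \neq_Y f(x') \Rightarrow x \neq_X x'$ for all $x,x'$; it preserves the relations if $x <_X x' \Rightarrow f(x) <_Y f(x')$ for all $x,x'$. A formula $P(x)$ on $X$ is extensional if $x =_X y$ and $P(x)$ imply $P(y)$; subsets are given by extensional formulas. A set with an extensional inequality and relation $\mathcal{X}$ is an $\exists$-well-founded set if for all extensional formulas $Q(x), P(x)$ on $X$ with $$\forall_{x \in X}\Big(Q(x) \Rightarrow \big[P(x) \vee \exists_{x' \in X}(x' <_X x \ \&\ Q(x'))\big]\Big),$$ one has $\exists_{x \in X} Q(x) \Rightarrow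 \exists_{x \in X} P(x)$. $\mathbf{2} := \{0,1\}$ carries the equality, inequality and order $=_{\mathbf{2}}, \neq_{\mathbf{2}}, <_{\mathbf{2}}$ restricted from $\mathbb{N}$. *)

(* Defs.v *)
From Stdlib Require Export RelationClasses Morphisms.
From Stdlib Require Import Program.Basics.

Set Implicit Arguments.
Unset Strict Implicit.

(** The data (X, =_X, <>_X, <_X); the axioms are in [is_ineq_rel_set].  The
    equality [eqX] is a setoid equality, not Leibniz equality. *)
Record rel_struct : Type := RelStruct {
  carrier :> Type;
  eqX : carrier -> carrier -> Prop;
  neqX : carrier -> carrier -> Prop;
  ltX : carrier -> carrier -> Prop
}.

Arguments eqX {r} _ _.
Arguments neqX {r} _ _.
Arguments ltX {r} _ _.

Definition botN : Prop := 0 = 1.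

Record is_ineq_rel_set (X : rel_struct) : Prop := IsIneqRelSet {
  eqX_equivalence : Equivalence (@eqX X);
  eqX_neqX_bot : forall x y : X, eqX x y /\ neqX x y -> botN;
  neqX_sym : forall x y : X, neqX x y -> neqX y x;
  neqX_ext : Proper (@eqX X ==> @eqX X ==> impl) (@neqX X);
  ltX_ext : Proper (@eqX X ==> @eqX X ==> impl) (@ltX X)
}.

Definition strong (X : rel_struct) : Prop :=
  forall x x' : X, ltX x x' -> neqX x x'.

Definition dichotomous (X : rel_struct) : Prop :=
  forall x x' : X, neqX x x' -> ltX x x' \/ ltX x' x.

Definition is_function (X Y : rel_struct) (f : X -> Y) : Prop :=
  Proper (@eqX X ==> @eqX Y) f.

Definition strongly_extensional (X Y : rel_struct) (f : X -> Y) : Prop :=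
  forall x x' : X, neqX (f x) (f x') -> neqX x x'.

Definition preserves_rel (X Y : rel_struct) (f : X -> Y) : Prop :=
  forall x x' : X, ltX x x' -> ltX (f x) (f x').

Definition extensional (X : rel_struct) (P : X -> Prop) : Prop :=
  Proper (@eqX X ==> impl) P.

Definition ex_well_founded (X : rel_struct) : Prop :=
  is_ineq_rel_set X /\
  forall Q P : X -> Prop, extensional Q -> extensional P ->
    (forall x : X, Q x -> P x \/ exists x' : X, ltX x' x /\ Q x') ->
    (exists x : X, Q x) -> exists x : X, P x.

Definition subset_struct (X : rel_struct) (A : X -> Prop) : rel_struct := {|
  carrier := {x : X | A x};
  eqX a b := eqX (proj1_sig a) (proj1_sig b);
  neqX a b := neqX (proj1_sig a) (proj1_sig b);
  ltX a b := ltX (proj1_sig a) (proj1_sig b)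
|}.

Definition prod_struct (X Y : rel_struct) : rel_struct := {|
  carrier := X * Y;
  eqX p q := eqX (fst p) (fst q) /\ eqX (snd p) (snd q);
  neqX p q := neqX (fst p) (fst q) \/ neqX (snd p) (snd q);
  ltX p q := ltX (fst p) (fst q) /\ ltX (snd p) (snd q)
|}.

(** In the sum, [inl x] is the pair (0, x) and [inr y] the pair (1, y).  The
    first component [tag] lies in {0, 1}, whose equality, inequality and order
    are those of [nat]. *)
Definition tag (S T : Type) (p : S + T) : nat :=
  match p with inl _ => 0 | inr _ => 1 end.

(** "i = j = 0 and R z u" for p = (i, z) and q = (j, u): the second components
    lie in [S] only once the tags are known, hence the existentials. *)
Definition both_left (S T : Type) (R : S -> S -> Prop) (p q : S + T) : Prop :=
  exists z u : S, p = inl z /\ q = inl u /\ R z u.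

Definition both_right (S T : Type) (R : T -> T -> Prop) (p q : S + T) : Prop :=
  exists z u : T, p = inr z /\ q = inr u /\ R z u.

Definition sum_struct (X Y : rel_struct) : rel_struct := {|
  carrier := X + Y;
  eqX p q := both_left (@eqX X) p q \/ both_right (@eqX Y) p q;
  neqX p q := tag p <> tag q \/
    both_left (@neqX X) p q \/ both_right (@neqX Y) p q;
  ltX p q := tag p < tag q \/
    both_left (@ltX X) p q \/ both_right (@ltX Y) p q
|}.

(* Main.v *)
Require Import Defs.
From Stdlib Require Import Lia.

Set Implicit Arguments.
Unset Strict Implicit.

(** Everything rests on one reading of the definition: if [Q] either establishes
    a fixed proposition [C] or descends along [<], then an inhabited [Q]
    establishes [C] ([ex_well_founded_elim], the case of a constant [P]).
    With [C := exists z, P z], this lets the property [Q] be transported between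
    structures without transporting [P].

    For a function [f : Z -> X] preserving the relations, the direct image of [Q]
    descends in [X] whenever [Q] descends in [Z], so well-foundedness pulls back
    along [f] ([ex_well_founded_preimage]).  A subset is pulled back along its
    inclusion, and a product along its first projection, since a descent of pairs
    is in particular a descent of first components.

    The sum need not admit such a function to [X] or [Y].  In it the left summand
    lies below the right one and nothing outside it lies below any of its
    elements.  Hence a descent that starts on the left stays in [X] and
    terminates; one that starts on the right either stays in [Y] and terminates
    or drops to the left, where the first case applies.  Every case distinction is
    supplied by the descent hypothesis or read off from a tag, so the argument is constructive. *)

(** * Descent and pullback *)

(** A constant formula is extensional, so [C] may be taken for [P]. *)
Lemma ex_well_founded_elim (X : rel_struct) (hX : ex_well_founded X)
  (Q : X -> Prop) (C : Prop) :
  extensional Q ->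
  (forall x, Q x -> C \/ exists x', ltX x' x /\ Q x') ->
  (exists x, Q x) -> C.
Proof.
  intros extQ descQ exQ.
  destruct hX as [_ wfX].
  destruct (wfX Q (fun _ => C) extQ) as [_ c]; auto.
  intros x x' _ c; exact c.
Qed.

Lemma ex_well_founded_preimage (X Z : rel_struct) (f : Z -> X) :
  ex_well_founded X -> is_ineq_rel_set Z -> preserves_rel f ->
  ex_well_founded Z.
Proof.
  intros hX hZ f_lt; split; [exact hZ |].
  intros Q P _ _ descQ [z0 Qz0].
  destruct (proj1 hX) as [eqvX _ _ _ ltX_proper].
  (* [=_X] is not Leibniz equality: the image has to be saturated under it to
     be extensional. *)
  apply (ex_well_founded_elim hX (Q := fun x => exists z, eqX (f z) x /\ Q z)).
  - intros x x' xx' [z [fzx Qz]].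
    exists z; split; [transitivity x; assumption | exact Qz].
  - intros x [z [fzx Qz]].
    destruct (descQ z Qz) as [Pz | [z' [z'z Qz']]]; [left; eauto | right].
    exists (f z'); split.
    + refine (ltX_proper (f z') (f z') _ (f z) x fzx _); [reflexivity | auto].
    + exists z'; split; [reflexivity | exact Qz'].
  - exists (f z0), z0; split; [reflexivity | exact Qz0].
Qed.

Lemma strong_preimage (X Z : rel_struct) (f : Z -> X) :
  strongly_extensional f -> preserves_rel f -> strong X -> strong Z.
Proof. unfold strong; auto. Qed.

(** * Subsets *)

Lemma is_ineq_rel_set_subset (X : rel_struct) (A : X -> Prop) :
  is_ineq_rel_set X -> is_ineq_rel_set (subset_struct A).
Proof.
  intros [[r s t] bot sym next lext]; split; simpl.
  - split; red; simpl; eauto.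
  - intros x y; apply bot.
  - intros x y; apply sym.
  - intros x x' xx' y y' yy'; exact (next _ _ xx' _ _ yy').
  - intros x x' xx' y y' yy'; exact (lext _ _ xx' _ _ yy').
Qed.

Lemma ex_well_founded_subset (X : rel_struct) (A : X -> Prop) :
  ex_well_founded X -> ex_well_founded (subset_struct A).
Proof.
  intros hX.
  apply (ex_well_founded_preimage (X := X) (Z := subset_struct A)
    (f := @proj1_sig X A) hX).
  - apply is_ineq_rel_set_subset, hX.
  - intros a b ab; exact ab.
Qed.

(** * Products *)

Lemma is_ineq_rel_set_prod (X Y : rel_struct) :
  is_ineq_rel_set X -> is_ineq_rel_set Y -> is_ineq_rel_set (prod_struct X Y).
Proof.
  intros [[rX sX tX] botX symX nextX lextX] [[rY sY tY] botY symY nextY lextY].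
  split; simpl.
  - split; red; simpl; intuition eauto.
  - intros p q [[eq1 eq2] [neq | neq]]; eauto.
  - intuition auto.
  - intros p p' [pp1 pp2] q q' [qq1 qq2] [neq | neq].
    + left; exact (nextX _ _ pp1 _ _ qq1 neq).
    + right; exact (nextY _ _ pp2 _ _ qq2 neq).
  - intros p p' [pp1 pp2] q q' [qq1 qq2] [lt1 lt2]; split.
    + exact (lextX _ _ pp1 _ _ qq1 lt1).
    + exact (lextY _ _ pp2 _ _ qq2 lt2).
Qed.

Lemma ex_well_founded_prod (X Y : rel_struct) :
  ex_well_founded X -> is_ineq_rel_set Y -> ex_well_founded (prod_struct X Y).
Proof.
  intros hX hY.
  apply (ex_well_founded_preimage (X := X) (Z := prod_struct X Y)
    (f := @fst X Y) hX).
  - apply is_ineq_rel_set_prod; [apply hX | exact hY].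
  - intros p q [lt1 _]; exact lt1.
Qed.

Lemma strong_prod (X Y : rel_struct) :
  strong X \/ strong Y -> strong (prod_struct X Y).
Proof.
  intros [sX | sY] p q [lt1 lt2]; [left | right]; auto.
Qed.

(** * Sums *)

(** The relations of the sum are given by existentials and equations between
    pairs.  Deciding them by the tags, here and in the four lemmas below, turns
    each axiom of the sum into the corresponding axiom of [X] or [Y]. *)
Lemma both_leftE (S T : Type) (R : S -> S -> Prop) (p q : S + T) :
  both_left R p q <->
  match p, q with inl z, inl u => R z u | _, _ => False end.
Proof.
  split.
  - intros (z & u & -> & -> & zu); exact zu.
  - destruct p as [z |], q as [u |]; try contradiction.
    intros zu; exists z, u; auto.
Qed.

Lemma both_rightE (S T : Type) (R : T -> T -> Prop) (p q : S + T) :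
  both_right R p q <->
  match p, q with inr z, inr u => R z u | _, _ => False end.
Proof.
  split.
  - intros (z & u & -> & -> & zu); exact zu.
  - destruct p as [| z], q as [| u]; try contradiction.
    intros zu; exists z, u; auto.
Qed.

Lemma eqX_sumE (X Y : rel_struct) (p q : sum_struct X Y) :
  eqX p q <->
  match p, q with
  | inl z, inl u => eqX z u
  | inr z, inr u => eqX z u
  | _, _ => False
  end.
Proof.
  simpl; rewrite both_leftE, both_rightE.
  destruct p, q; intuition auto.
Qed.

Lemma neqX_sumE (X Y : rel_struct) (p q : sum_struct X Y) :
  neqX p q <->
  match p, q with
  | inl z, inl u => neqX z u
  | inr z, inr u => neqX z u
  | _, _ => True
  end.
Proof.
  simpl; rewrite both_leftE, both_rightE.
  destruct p, q; simpl; intuition congruence.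
Qed.

Lemma ltX_sumE (X Y : rel_struct) (p q : sum_struct X Y) :
  ltX p q <->
  match p, q with
  | inl z, inl u => ltX z u
  | inr z, inr u => ltX z u
  | inl _, inr _ => True
  | inr _, inl _ => False
  end.
Proof.
  simpl; rewrite both_leftE, both_rightE.
  destruct p, q; simpl; intuition lia.
Qed.

Lemma is_ineq_rel_set_sum (X Y : rel_struct) :
  is_ineq_rel_set X -> is_ineq_rel_set Y -> is_ineq_rel_set (sum_struct X Y).
Proof.
  intros [[rX sX tX] botX symX nextX lextX] [[rY sY tY] botY symY nextY lextY].
  split; [split |..].
  - intros p; rewrite eqX_sumE; destruct p; auto.
  - intros p q; rewrite !eqX_sumE; destruct p, q; auto.
  - intros p q r; rewrite !eqX_sumE; destruct p, q, r; try contradiction; eauto.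
  - intros p q; rewrite eqX_sumE, neqX_sumE; destruct p, q; try tauto.
    + apply botX.
    + apply botY.
  - intros p q; rewrite !neqX_sumE; destruct p, q; auto.
  - intros p p' pp' q q' qq'; red; revert pp' qq'.
    rewrite !eqX_sumE, !neqX_sumE.
    destruct p, p', q, q'; try tauto; intros pp' qq'.
    + exact (nextX _ _ pp' _ _ qq').
    + exact (nextY _ _ pp' _ _ qq').
  - intros p p' pp' q q' qq'; red; revert pp' qq'.
    rewrite !eqX_sumE, !ltX_sumE.
    destruct p, p', q, q'; try tauto; intros pp' qq'.
    + exact (lextX _ _ pp' _ _ qq').
    + exact (lextY _ _ pp' _ _ qq').
Qed.

(** The right summand is handled after the left one: inside [Y], a drop to the
    left counts as success, because it already yields the conclusion. *)
Lemma ex_well_founded_sum (X Y : rel_struct) :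
  ex_well_founded X -> ex_well_founded Y -> ex_well_founded (sum_struct X Y).
Proof.
  intros hX hY; split; [apply is_ineq_rel_set_sum; [apply hX | apply hY] |].
  intros Q P extQ _ descQ exQ.
  assert (from_left : (exists x, Q (inl x)) -> exists p, P p).
  { apply (ex_well_founded_elim hX).
    - intros x x' xx'; apply extQ, eqX_sumE; exact xx'.
    - intros x Qx.
      destruct (descQ _ Qx) as [Px | [[x' | y'] [lt Q']]]; [left; eauto | |];
        rewrite ltX_sumE in lt; [right; eauto | contradiction]. }
  assert (from_right : (exists y, Q (inr y)) -> exists p, P p).
  { apply (ex_well_founded_elim hY).
    - intros y y' yy'; apply extQ, eqX_sumE; exact yy'.
    - intros y Qy.
      destruct (descQ _ Qy) as [Py | [[x' | y'] [lt Q']]]; [left; eauto | |];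
        rewrite ltX_sumE in lt; [left; eauto | right; eauto]. }
  destruct exQ as [[x | y] Q0]; eauto.
Qed.

Lemma strong_sum (X Y : rel_struct) :
  strong X -> strong Y -> strong (sum_struct X Y).
Proof.
  intros sX sY p q; rewrite ltX_sumE, neqX_sumE.
  destruct p, q; auto.
Qed.

Lemma dichotomous_sum (X Y : rel_struct) :
  dichotomous X -> dichotomous Y -> dichotomous (sum_struct X Y).
Proof.
  intros dX dY p q; rewrite !ltX_sumE, neqX_sumE.
  destruct p, q; auto.
Qed.

(** * Closure properties of well-founded sets *)

Theorem proposition6p4 (X Y : rel_struct)
  (hX : ex_well_founded X) (hY : ex_well_founded Y)
  (A : X -> Prop) (hA : extensional A) :
  (forall (Z : rel_struct) (f : Z -> X),
      is_ineq_rel_set Z -> is_function f ->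
      strongly_extensional f -> preserves_rel f ->
      ex_well_founded Z /\ (strong X -> strong Z)) /\
  ex_well_founded (subset_struct A) /\
  (ex_well_founded (prod_struct X Y) /\
   (strong X \/ strong Y -> strong (prod_struct X Y))) /\
  (ex_well_founded (sum_struct X Y) /\
   (strong X /\ strong Y -> strong (sum_struct X Y)) /\
   (dichotomous X /\ dichotomous Y -> dichotomous (sum_struct X Y))).
Proof.
  split; [| split; [| split; [split | split; [| split]]]].
  - intros Z f hZ _ f_se f_lt; split.
    + exact (ex_well_founded_preimage hX hZ f_lt).
    + exact (strong_preimage f_se f_lt).
  - exact (ex_well_founded_subset A hX).
  - exact (ex_well_founded_prod hX (proj1 hY)).
  - apply strong_prod.
  - exact (ex_well_founded_sum hX hY).
  - intros [sX sY]; exact (strong_sum sX sY).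
  - intros [dX dY]; exact (dichotomous_sum dX dY).
Qed.
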